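(* Let $n$ and $d\ge 2$ be positive integers, and let $K$ be a field of characteristic $0$ containing a primitive $n$-th root of unity. Then the coalgebra $C_d(n)$ over $K$ admits a Hopf algebra structure (that is, there is a Hopf algebra over $K$ whose underlying coalgebra is $C_d(n)$) if and only if $d\mid n$.
   Context: $Z_n$ is the basic cycle of length $n$: the quiver with $n$ vertices $e_0,\dots,e_{n-1}$ and exactly one arrow $\alpha_i$ from $e_i$ to $e_{i+1}$ for each $0\le i\le n-1$ (indices modulo $n$). For $l\ge 0$, $p_i^l$ denotes the path of length $l$ starting at $e_i$ (so $p_i^0=e_i$, $p_i^1=\alpha_i$). The path coalgebra $KZ_n^c$ is the $K$-space with basis all paths, with comultiplication $\Delta(p_i^l)=\sum_{r=0}^{l}p_{i+r}^{l-r}\otimes p_i^r$ and counit $\varepsilon(p_i^l)=1$ if $l=0$ and $0$ if $l\ge1$. $C_d(n)$ is the subcoalgebra of $KZ_n^c$ with basis all paths of length strictly smaller than $d$; it has dimension $nd$. *)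

(* Defs.v *)
From HB Require Import structures.
From mathcomp Require Import all_boot all_order all_algebra.

Set Implicit Arguments.
Unset Strict Implicit.
Unset Printing Implicit Defensive.

Import GRing.Theory.
Local Open Scope ring_scope.

(* The tensor product of two finite-dimensional vector spaces is modelled by
   coordinate matrices in the bases [vbasis fullv] of the two factors. *)
Definition tensor (K : fieldType) (V W : vectType K) : vectType K :=
  'M[K]_(\dim {:V}, \dim {:W}).

Definition tens (K : fieldType) (V W : vectType K) (x : V) (y : W) :
    tensor V W :=
  (\matrix_(i, j) (coord (vbasis {:V}) i x * coord (vbasis {:W}) j y)
    : 'M[K]_(\dim {:V}, \dim {:W})).

Notation "x ⊗ y" := (tens x y) (at level 40, left associativity) : ring_scope.

(* [tlift f] is, for a bilinear [f], the linear map on [tensor V W] induced by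
   [f] (lemmas [tlift_is_linear] and [tlift_tens]). In Sweedler notation,
   [tlift f (Delta c)] is the sum of the [f c_(1) c_(2)]. *)
Definition tlift (K : fieldType) (V W U : vectType K) (f : V -> W -> U)
    (z : tensor V W) : U :=
  \sum_i \sum_j (z : 'M[K]_(\dim {:V}, \dim {:W})) i j *:
     f (vbasis {:V})`_i (vbasis {:W})`_j.

Section TensorTheory.
Variable K : fieldType.
Implicit Types V W U : vectType K.

Lemma tlift_is_linear V W U (f : V -> W -> U) : linear (tlift f).
Proof.
move=> a u v; rewrite /tlift scaler_sumr -big_split /=; apply: eq_bigr => i _.
rewrite scaler_sumr -big_split /=; apply: eq_bigr => j _.
by rewrite !mxE scalerDl scalerA.
Qed.

HB.instance Definition _ V W U (f : V -> W -> U) :=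
  GRing.isLinear.Build K (tensor V W) U *:%R (tlift f) (@tlift_is_linear V W U f).

Lemma tlift_tens V W U (f : V -> W -> U) x y :
  (forall w, linear (f^~ w)) -> (forall v, linear (f v)) ->
  tlift f (x ⊗ y) = f x y.
Proof.
move=> fl fr.
have suml w (I : finType) (c : I -> K) (F : I -> V) :
    f (\sum_i c i *: F i) w = \sum_i c i *: f (F i) w.
  pose g := GRing.isLinear.Build K V U *:%R (f^~ w) (fl w).
  pose gl : {linear V -> U} := HB.pack (f^~ w) g.
  by rewrite -[LHS]/(gl _) linear_sum; apply: eq_bigr => i _; rewrite linearZ.
have sumr v (I : finType) (c : I -> K) (F : I -> W) :
    f v (\sum_i c i *: F i) = \sum_i c i *: f v (F i).
  pose g := GRing.isLinear.Build K W U *:%R (f v) (fr v).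
  pose gl : {linear W -> U} := HB.pack (f v) g.
  by rewrite -[LHS]/(gl _) linear_sum; apply: eq_bigr => i _; rewrite linearZ.
rewrite [in RHS](coord_vbasis (memvf x)) suml /tlift; apply: eq_bigr => i _.
rewrite [in RHS](coord_vbasis (memvf y)) sumr scaler_sumr.
by apply: eq_bigr => j _; rewrite mxE scalerA.
Qed.

Lemma tens_linearl V W (w : W) : linear (fun v : V => v ⊗ w).
Proof.
by move=> a u v; apply/matrixP => i j; rewrite !mxE linearP mulrDl mulrA.
Qed.

Lemma tens_linearr V W (v : V) : linear (fun w : W => v ⊗ w).
Proof.
by move=> a u w; apply/matrixP => i j; rewrite !mxE linearP mulrDr mulrCA.
Qed.

HB.instance Definition _ V W (v : V) :=
  GRing.isLinear.Build K W (tensor V W) *:%R (tens v) (@tens_linearr V W v).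

End TensorTheory.

Record coalgebra (K : fieldType) := Coalgebra {
  coalg_sort :> vectType K;
  Delta : {linear coalg_sort -> tensor coalg_sort coalg_sort};
  counit : {linear coalg_sort -> K^o};
  (* [tensor] is not strictly associative: the left-hand side is rebracketed
     as [x1 ⊗ (x2 ⊗ y)]. *)
  coassoc : forall c,
    tlift (fun x y => tlift (fun x1 x2 => x1 ⊗ (x2 ⊗ y)) (Delta x)) (Delta c) =
    tlift (fun x y => x ⊗ Delta y) (Delta c);
  counitl : forall c, tlift (fun x y => counit x *: y) (Delta c) = c;
  counitr : forall c, tlift (fun x y => counit y *: x) (Delta c) = c
}.

Arguments Delta {K _}.
Arguments counit {K _}.

Record hopf_structure (K : fieldType) (C : coalgebra K) := HopfStructure {
  hmul : {linear tensor C C -> C};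
  hone : C;
  antipode : {linear C -> C};
  hmulA : forall x y z,
    hmul (x ⊗ hmul (y ⊗ z)) = hmul (hmul (x ⊗ y) ⊗ z);
  hmul1l : forall x, hmul (hone ⊗ x) = x;
  hmul1r : forall x, hmul (x ⊗ hone) = x;
  Delta_one : Delta hone = hone ⊗ hone;
  Delta_mul : forall x y,
    Delta (hmul (x ⊗ y)) =
    tlift (fun x1 x2 =>
      tlift (fun y1 y2 => hmul (x1 ⊗ y1) ⊗ hmul (x2 ⊗ y2)) (Delta y)) (Delta x);
  counit_one : counit hone = 1;
  counit_mul : forall x y,
    counit (hmul (x ⊗ y)) = (counit x : K) * (counit y : K);
  antipodel : forall x,
    tlift (fun x1 x2 => hmul (antipode x1 ⊗ x2)) (Delta x) = counit x *: hone;
  antipoder : forall x,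
    tlift (fun x1 x2 => hmul (x1 ⊗ antipode x2)) (Delta x) = counit x *: hone
}.

Section TruncatedCycle.
Variables (K : fieldType) (n d : nat).

(* The pair [(i, l)] stands for the path of length [l < d] of the basic cycle
   of length [n] starting at the vertex [i]. *)
Definition tpath : finType := ('I_n * 'I_d)%type.

Definition Cd_space : vectType K := {ffun tpath -> K^o}.

(* The basis vector of the path of length [l] starting at [i] modulo [n]
   (and 0 if [d <= l]). *)
Definition pathv (i l : nat) : Cd_space :=
  [ffun q : tpath => ((q.1 == (i %% n)%N :> nat) && (q.2 == l :> nat))%:R : K^o].

(* The comultiplication of the path coalgebra of the basic cycle, on basis
   vectors (lemma [Cd_DeltaE]) and extended linearly. It restricts to the span
   of the paths of length [< d], since only paths of length at most [l] occur
   in the comultiplication of a path of length [l]. *)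
Definition Cd_Delta (x : Cd_space) : tensor Cd_space Cd_space :=
  \sum_(q : tpath) (x q : K) *:
    \sum_(r < (q.2 : nat).+1) (pathv (q.1 + r) (q.2 - r) ⊗ pathv q.1 r).

Definition Cd_counit (x : Cd_space) : K^o :=
  \sum_(q : tpath) (x q : K) * ((q.2 : nat) == 0)%:R.

Lemma Cd_Delta_is_linear : linear Cd_Delta.
Proof.
move=> a x y; rewrite /Cd_Delta scaler_sumr -big_split /=.
by apply: eq_bigr => q _; rewrite !ffunE scalerDl scalerA.
Qed.

HB.instance Definition _ :=
  GRing.isLinear.Build K Cd_space (tensor Cd_space Cd_space) *:%R Cd_Delta
    Cd_Delta_is_linear.

Lemma Cd_counit_is_linear : linear Cd_counit.
Proof.
move=> a x y; rewrite /Cd_counit scaler_sumr -big_split /=.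
by apply: eq_bigr => q _; rewrite !ffunE mulrDl -mulrA.
Qed.

HB.instance Definition _ :=
  GRing.isLinear.Build K Cd_space K^o *:%R Cd_counit Cd_counit_is_linear.

Lemma pathv_mod i l : pathv (i %% n) l = pathv i l.
Proof. by apply/ffunP => q; rewrite !ffunE modn_mod. Qed.

Lemma Cd_space_sum (x : Cd_space) :
  x = \sum_(q : tpath) (x q : K) *: pathv q.1 q.2.
Proof.
apply/ffunP => q; rewrite sum_ffunE (bigD1 q) //= big1 => [|p /negbTE pq].
  by rewrite !ffunE modn_small // !eqxx addr0 [RHS]mulr1.
rewrite !ffunE modn_small // !val_eqE -xpair_eqE -!surjective_pairing eq_sym pq.
by rewrite [LHS]mulr0.
Qed.

Lemma Cd_sum_pathv (U : lmodType K) (F : tpath -> U) (i : 'I_n) (l : 'I_d) :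
  \sum_q (pathv i l q : K) *: F q = F (i, l).
Proof.
rewrite (bigD1 (i, l)) //= big1 => [|p /negbTE pq].
  by rewrite ffunE modn_small // !eqxx scale1r addr0.
by rewrite ffunE modn_small // !val_eqE -xpair_eqE -surjective_pairing pq scale0r.
Qed.

Lemma Cd_DeltaE (i l : nat) : (0 < n)%N -> (l < d)%N ->
  Cd_Delta (pathv i l) =
  \sum_(r < l.+1) (pathv (i + r) (l - r) ⊗ pathv i r).
Proof.
move=> n0 ld; rewrite -pathv_mod.
have im : (i %% n < n)%N by rewrite ltn_mod.
rewrite /Cd_Delta (Cd_sum_pathv _ (Ordinal im) (Ordinal ld)) /=.
apply: eq_bigr => r _; rewrite pathv_mod; congr (_ ⊗ _).
by rewrite -pathv_mod modnDml pathv_mod.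
Qed.

Lemma Cd_counitE (i l : nat) : (0 < n)%N -> (l < d)%N ->
  Cd_counit (pathv i l) = (l == 0)%:R.
Proof.
move=> n0 ld; rewrite -pathv_mod.
have im : (i %% n < n)%N by rewrite ltn_mod.
exact: (@Cd_sum_pathv K^o (fun q => ((q.2 : nat) == 0)%:R) (Ordinal im) (Ordinal ld)).
Qed.

Lemma Cd_linear_ext (U : lmodType K) (f g : {linear Cd_space -> U}) :
  (forall i l, (0 < n)%N -> (l < d)%N -> f (pathv i l) = g (pathv i l)) ->
  f =1 g.
Proof.
move=> fg x; rewrite (Cd_space_sum x) !linear_sum; apply: eq_bigr => -[i l] _.
by rewrite !linearZ fg //=; apply: leq_ltn_trans (ltn_ord i).
Qed.

Lemma Cd_coassoc c :
  tlift (fun x y => tlift (fun x1 x2 => x1 ⊗ (x2 ⊗ y)) (Cd_Delta x))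
    (Cd_Delta c) =
  tlift (fun x y => x ⊗ Cd_Delta y) (Cd_Delta c).
Proof.
have il (y : Cd_space) u : linear (fun x1 : Cd_space => x1 ⊗ (u ⊗ y)).
  exact: tens_linearl.
have ir (y v : Cd_space) : linear (fun x2 : Cd_space => v ⊗ (x2 ⊗ y)).
  by move=> a s t; rewrite tens_linearl linearP.
pose L : Cd_space -> Cd_space -> _ := fun x y =>
  tlift (fun x1 x2 => x1 ⊗ (x2 ⊗ y)) (Cd_Delta x).
have Ll w : linear (L^~ w) by move=> a s t; rewrite /L !linearP.
have Lr v : linear (L v).
  move=> a s t; rewrite /L /tlift scaler_sumr -big_split /=.
  apply: eq_bigr => i _; rewrite scaler_sumr -big_split /=.
  by apply: eq_bigr => j _; rewrite !linearP.
pose R : Cd_space -> Cd_space -> _ := fun x y => x ⊗ Cd_Delta y.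
have Rl w : linear (R^~ w) by apply: tens_linearl.
have Rr v : linear (R v) by move=> a s t; rewrite /R !linearP.
suff /(_ c) : tlift L \o Cd_Delta =1 tlift R \o Cd_Delta by [].
apply: Cd_linear_ext => i l n0 ld /=.
rewrite Cd_DeltaE // !linear_sum /=.
under eq_bigr => r _.
  rewrite tlift_tens // /L Cd_DeltaE // ?(leq_ltn_trans (leq_subr _ _)) //.
  rewrite linear_sum /=.
  under eq_bigr => s _ do rewrite tlift_tens // -addnA -subnDA.
  over.
under [RHS]eq_bigr => r _.
  rewrite tlift_tens // /R Cd_DeltaE // ?(leq_ltn_trans (leq_ord r)) //.
  rewrite linear_sum /=.
  over.
pose F a b := pathv (i + b) (l - b) ⊗ (pathv (i + a) (b - a) ⊗ pathv i a).
transitivity (\sum_(0 <= a < l.+1) \sum_(a <= b < l.+1) F a b).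
  rewrite big_mkord; apply: eq_bigr => a _.
  rewrite -[X in \sum_(X <= _ < _) _](add0n a) big_addn subSn ?leq_ord // big_mkord.
  by apply: eq_bigr => s _; rewrite /F addnK [(s + a)%N]addnC.
transitivity (\sum_(0 <= b < l.+1) \sum_(0 <= a < b.+1) F a b); last first.
  rewrite big_mkord; apply: eq_bigr => b _; rewrite big_mkord.
  by apply: eq_bigr => a _.
transitivity (\sum_(0 <= a < l.+1) \sum_(0 <= b < l.+1 | (a <= b)%N) F a b).
  apply: eq_big_nat => a /andP[_ al].
  by rewrite (big_nat_widenl a 0) //; apply: eq_bigl => b; rewrite andTb.
rewrite (exchange_big_dep xpredT) //=; apply: eq_big_nat => b /andP[_ bl].
rewrite [RHS](big_nat_widen _ _ l.+1) //.
Qed.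

Lemma Cd_counitl c :
  tlift (fun x y => Cd_counit x *: y) (Cd_Delta c) = c.
Proof.
pose L : Cd_space -> Cd_space -> Cd_space := fun x y => Cd_counit x *: y.
have Ll w : linear (L^~ w).
  by move=> a s t; rewrite /L linearP scalerDl scalerA.
have Lr v : linear (L v).
  by move=> a s t; rewrite /L scalerDr !scalerA mulrC.
suff /(_ c) : tlift L \o Cd_Delta =1 idfun by [].
apply: Cd_linear_ext => i l n0 ld /=.
rewrite Cd_DeltaE // linear_sum big_ord_recr /= big1 => [|r _].
  by rewrite tlift_tens // /L Cd_counitE ?subnn // ?(leq_ltn_trans _ ld) // add0r scale1r.
rewrite tlift_tens // /L Cd_counitE // ?(leq_ltn_trans (leq_subr _ _)) //.
by rewrite subn_eq0 leqNgt ltn_ord scale0r.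
Qed.

Lemma Cd_counitr c :
  tlift (fun x y => Cd_counit y *: x) (Cd_Delta c) = c.
Proof.
pose L : Cd_space -> Cd_space -> Cd_space := fun x y => Cd_counit y *: x.
have Ll w : linear (L^~ w).
  by move=> a s t; rewrite /L scalerDr !scalerA mulrC.
have Lr v : linear (L v).
  by move=> a s t; rewrite /L linearP scalerDl scalerA.
suff /(_ c) : tlift L \o Cd_Delta =1 idfun by [].
apply: Cd_linear_ext => i l n0 ld /=.
rewrite Cd_DeltaE // linear_sum big_ord_recl /= big1 => [|r _].
  rewrite tlift_tens // /L Cd_counitE // ?(leq_ltn_trans _ ld) //.
  by rewrite addn0 subn0 addr0 scale1r.
rewrite tlift_tens // /L Cd_counitE // ?(leq_ltn_trans _ ld) // ?lift0 //.
by rewrite scale0r.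
Qed.

Definition Cd : coalgebra K :=
  @Coalgebra K Cd_space Cd_Delta Cd_counit Cd_coassoc Cd_counitl Cd_counitr.

End TruncatedCycle.

(* Main.v *)
From HB Require Import structures.
Require Import Defs.
From mathcomp Require Import all_boot all_order all_algebra.
From mathcomp Require Import ring zify.
Import GRing.Theory.
Local Open Scope ring_scope.
Set Implicit Arguments.
Unset Strict Implicit.
Unset Printing Implicit Defensive.

(** Write p_i^l for the path of length l starting at the vertex i, and G(N, a)
for the q-binomial coefficient N choose a at an element q of K. Both directions
rest on the equivalence between q being a primitive d-th root of unity and the
vanishing of all G(d, a) with 0 < a < d, the nontrivial half of which needs
characteristic 0 ([gauss_prim_eq0], [gauss_eq0_prim]).

If d divides n, choose such a q; then q^n = 1, so that
    p_i^l p_j^m = q^(j l) G(l + m, l) p_(i+j)^(l+m)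
is a well defined product. This is the generalized Taft algebra generated by a
grouplike g of order n and a skew primitive x with x^d = 0 and x g = q g x, in
the basis g^i x^l / [l]!, [l]! being the q-factorial. Associativity comes from
the factorial formula for G ([gauss_assoc]). Compatibility with the
comultiplication is the q-Vandermonde identity ([gauss_vandermonde]) together
with the vanishing of G(l + m, l) when l, m < d <= l + m, which is what allows
p^(l+m) to be 0 there ([tDelta_path]). The antipode axioms amount to the
vanishing of the alternating sum of the q^(k (k - 1) / 2) G(l, k)
([gauss_alternating], [tcoef_sum]).

Conversely, let C_d(n) carry a Hopf algebra structure. Its grouplike elements
are the vertices ([grouplike_vertex]), so the vertices form a group. Let e_i be
the vertex reached after i steps from the unit of the algebra, and now number
the paths from that vertex. The product of an arrow and a vertex is skew
primitive and is not a combination of vertices, so it joins consecutive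
vertices; hence e_i e_j = e_(i+j) ([upath_vertexM]). Let [len l] be the sum of
the coordinates along the paths of length l. The values u_ij of [len 1] at
p_i^1 e_j and v_ij at e_i p_j^1 inherit cocycle identities from associativity,
and these force v_ij = w_(i+j) / w_j and u_ij = q^j w_(i+j) / w_i for some
nonvanishing w and some q with q^n = 1 ([exists_twist]). As [len (l + 1)] is
the convolution of [len 1] and [len l], the numbers N(a, b), defined as
[len (a + b)] at p_0^a p_0^b, satisfy
    N(a+1, b+1) = u_(a,b+1) N(a, b+1) + v_(a+1,b) N(a+1, b),
which is the Pascal rule up to the factors w; thus N(a, b) is a nonzero
multiple of G(a + b, a) ([len_mul_gauss]). There are no paths of length d, so
[len d] = 0, and G(d, a) = 0 for 0 < a < d. Hence q is a primitive d-th root of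
unity, and q^n = 1 gives that d divides n. The coradical filtration enters
only through the vanishing of [len l] at p_i^a p_j^b when a + b < l
([len_mul_lt]). *)

(** * Gaussian binomial coefficients *)

Section Gauss.
Variables (R : comNzRingType) (q : R).

Fixpoint gauss (N a : nat) : R :=
  match N, a with
  | _, 0 => 1
  | 0, _.+1 => 0
  | N'.+1, a'.+1 => q ^+ (N' - a') * gauss N' a' + gauss N' a'.+1
  end.

Definition qnum (k : nat) : R := \sum_(i < k) q ^+ i.

Definition qfact (k : nat) : R := \prod_(i < k) qnum i.+1.

Lemma gaussn0 N : gauss N 0 = 1. Proof. by case: N. Qed.

Lemma gaussS N a :
  gauss N.+1 a.+1 = q ^+ (N - a) * gauss N a + gauss N a.+1.
Proof. by []. Qed.

Arguments gauss : simpl never.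

Lemma gauss_small N a : (N < a)%N -> gauss N a = 0.
Proof.
elim: N a => [|N IHN] [|a] // Na.
by rewrite gaussS !IHN ?mulr0 ?addr0 // ltnW.
Qed.

Lemma gaussnn N : gauss N N = 1.
Proof.
elim: N => // N IHN.
by rewrite gaussS IHN subnn gauss_small // addr0 mulr1.
Qed.

Lemma gaussn1 N : gauss N 1 = qnum N.
Proof.
elim: N => [|N IHN]; first by rewrite /qnum big_ord0.
by rewrite gaussS IHN gaussn0 subn0 mulr1 addrC /qnum big_ord_recr.
Qed.

Lemma qnumD a b : qnum (a + b) = qnum a + q ^+ a * qnum b.
Proof.
rewrite /qnum big_split_ord /= mulr_sumr; congr (_ + _).
by apply: eq_bigr => i _; rewrite exprD.
Qed.

Lemma qfactS k : qfact k.+1 = qfact k * qnum k.+1.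
Proof. by rewrite /qfact big_ord_recr. Qed.

(** Stated without division, so that it remains true, and informative, when q is
a root of unity and some of the q-factorials vanish. *)
Lemma gauss_fact a b :
  gauss (a + b) a * qfact a * qfact b = qfact (a + b).
Proof.
have qfact0 : qfact 0 = 1 by rewrite /qfact big_ord0.
have [s] := ubnP (a + b); elim: s a b => // s IHs [|a] [|b] lt_s.
- by rewrite qfact0 gaussn0 !mulr1.
- by rewrite qfact0 gaussn0 !mul1r.
- by rewrite addn0 gaussnn qfact0 mul1r mulr1.
have IHa := IHs a b.+1 ltac:(lia).
have := IHs a.+1 b ltac:(lia); rewrite addSnnS => IHb.
have Eqn : qnum (a + b.+1).+1 = qnum b.+1 + q ^+ b.+1 * qnum a.+1.
  by rewrite -qnumD; congr qnum; lia.
rewrite addSn gaussS [in RHS]qfactS Eqn (_ : a + b.+1 - a = b.+1)%N; last lia.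
rewrite [in RHS]mulrDr -[X in X * qnum b.+1]IHb -IHa !qfactS.
ring.
Qed.

(** Combinatorially: cut a lattice path with T + N steps after T of them, r of
which go in the first direction. When r > T the truncated exponent is harmless,
because the last factor is 0. *)
Lemma gauss_vandermonde T N l :
  gauss (T + N) l =
  \sum_(r < l.+1) q ^+ ((T - r) * (l - r)) * gauss N (l - r) * gauss T r.
Proof.
elim: N l => [|N IHN] l.
  rewrite addn0 big_ord_recr /= big1 => [|r _].
    by rewrite subnn muln0 expr0 mul1r mul1r add0r.
  by rewrite [gauss 0 _]gauss_small ?subn_gt0 // mulr0 mul0r.
case: l => [|l]; first by rewrite big_ord1 !gaussn0 subnn muln0 !mulr1.
rewrite addnS gaussS !IHN [X in _ + X = _]big_ord_recr [in RHS]big_ord_recr /=.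
rewrite mulr_sumr addrA -big_split /= subnn !gaussn0; congr (_ + _).
apply: eq_bigr => r _; have rl := leq_ord r.
rewrite subSn // gaussS mulrDr mulrDl; congr (_ + _).
have [rT|Tr] := leqP r T; last by rewrite [gauss T r]gauss_small // !mulr0.
have [lN|Nl] := leqP (l - r) N.
  rewrite !mulrA -!exprD; congr (q ^+ _ * _ * _); nia.
by rewrite [gauss N _]gauss_small // !mulr0 !mul0r mulr0.
Qed.

(** By the Pascal rule the sum of index N + 1 is 1 - q^N times the sum of index
N, so it vanishes as soon as the factor with N = 0 occurs: this is the value at
-1 of the product of the 1 + q^i X. *)
Lemma gauss_alternating l :
  \sum_(k < l.+2) (-1) ^+ k * q ^+ 'C(k, 2) * gauss l.+1 k = 0.
Proof.
have rec N : \sum_(k < N.+2) (-1) ^+ k * q ^+ 'C(k, 2) * gauss N.+1 k =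
    (1 - q ^+ N) * \sum_(k < N.+1) (-1) ^+ k * q ^+ 'C(k, 2) * gauss N k.
  pose F k := (-1) ^+ k * q ^+ 'C(k, 2) * gauss N k.
  have F0 : \sum_(k < N.+1) F k = \sum_(k < N.+2) F k.
    by rewrite [RHS]big_ord_recr /= {3}/F gauss_small // mulr0 addr0.
  rewrite mulrBl mul1r {1}F0 /F.
  rewrite big_ord_recl [in RHS]big_ord_recl /= !gaussn0.
  rewrite -addrA; congr (_ + _).
  rewrite mulr_sumr -sumrB; apply: eq_bigr => k _; rewrite /bump /= add1n.
  have kN := leq_ord k.
  rewrite gaussS mulrDr addrC; congr (_ + _).
  have -> : q ^+ N = q ^+ k * q ^+ (N - k) by rewrite -exprD subnKC.
  rewrite binS bin1 exprD exprS; ring.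
elim: l => [|l IHl]; rewrite rec ?expr0 ?subrr ?mul0r //.
by rewrite IHl mulr0.
Qed.

End Gauss.

Arguments gauss {R} q N a : simpl never.

(** * Gaussian binomials at roots of unity *)

Section GaussRootOfUnity.
Variables (K : fieldType) (q : K).

Lemma qnumX1 k : (q - 1) * qnum q k = q ^+ k - 1.
Proof. by rewrite subrX1. Qed.

Lemma qnum_prim m k :
  m.-primitive_root q -> (0 < k < m)%N -> qnum q k != 0.
Proof.
move=> qm /andP[k0 km]; apply: contraTneq km => qk0; rewrite -leqNgt.
apply: dvdn_leq => //; rewrite (prim_order_dvd qm) -subr_eq0.
by rewrite -qnumX1 qk0 mulr0.
Qed.

Lemma qnum_prim_order m : m.-primitive_root q -> (1 < m)%N -> qnum q m = 0.
Proof.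
move=> qm m1; have : (q - 1) * qnum q m = 0.
  by rewrite qnumX1 (prim_expr_order qm) subrr.
move/eqP; rewrite mulf_eq0 => /orP[|/eqP//].
rewrite subr_eq0 -[q]expr1 -(prim_order_dvd qm) dvdn1 => /eqP m_eq1.
by rewrite m_eq1 in m1.
Qed.

Lemma qfact_prim m k : m.-primitive_root q -> (k < m)%N -> qfact q k != 0.
Proof.
move=> qm km; apply/prodf_neq0 => i _; apply: (qnum_prim qm) => /=.
exact: leq_ltn_trans (ltn_ord i) km.
Qed.

Lemma qfact_prim_ge m k :
  m.-primitive_root q -> (1 < m)%N -> (m <= k)%N -> qfact q k = 0.
Proof.
case: m => // m qm m1 mk; apply/eqP/prodf_eq0; exists (Ordinal mk) => //=.
exact/eqP/(qnum_prim_order qm).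
Qed.

Lemma gauss_prim_eq0 m a b : m.-primitive_root q ->
  (a < m)%N -> (b < m)%N -> (m <= a + b)%N -> gauss q (a + b) a = 0.
Proof.
move=> qm am bm mab; have m1 : (1 < m)%N by lia.
have /eqP := gauss_fact q a b; rewrite (qfact_prim_ge qm m1 mab).
by rewrite !mulf_eq0 (negbTE (qfact_prim qm am)) (negbTE (qfact_prim qm bm))
  !orbF => /eqP.
Qed.

(** In the Vandermonde identity with m steps split off, only the terms r = 0 and
r = m survive, and both have coefficient 1: each block of m steps adds 1. *)
Lemma gauss_prim_mul m k :
  m.-primitive_root q -> gauss q (m * k) m = k%:R.
Proof.
case: m => [|m] qm; first by have := prim_order_gt0 qm.
elim: k => [|k IHk]; first by rewrite muln0 gauss_small.
rewrite mulnS gauss_vandermonde big_ord_recl big_ord_recr /=.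
rewrite big1 ?add0r => [|i _].
  rewrite /bump /= add1n !subn0 !gaussn0 gaussnn subnn muln0 exprM.
  rewrite (prim_expr_order qm) expr1n.
  by rewrite expr0 !gaussn0 !mul1r !mulr1 IHk natr1.
suff -> : gauss q m.+1 (bump 0 i) = 0 by rewrite mulr0.
have im : (bump 0 i < m.+1)%N by rewrite /bump /= add1n ltnS.
have := @gauss_prim_eq0 _ _ (m.+1 - bump 0 i) qm im.
rewrite subnKC ?(ltnW im) // => -> //.
by rewrite /bump /= add1n subSS ltnS leq_subr.
Qed.

(** The case a = 1 says that q is a d-th root of unity, say of order m. If m
were smaller than d, the case a = m would give d / m = 0 in K. *)
Lemma gauss_eq0_prim d : [pchar K] =i pred0 -> (1 < d)%N ->
  (forall a, (0 < a < d)%N -> gauss q d a = 0) -> d.-primitive_root q.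
Proof.
move=> charK0 d1 g0; have d0 := ltnW d1.
have qd : q ^+ d = 1.
  by apply/eqP; rewrite -subr_eq0 -qnumX1 -gaussn1 g0 ?mulr0.
have [m qm md] := prim_order_exists d0 qd.
have m0 := prim_order_gt0 qm.
have [mltd|] := ltnP m d; last first.
  by move=> dm; rewrite (_ : d = m) //; apply/eqP; rewrite eqn_leq dm dvdn_leq.
have := g0 m; rewrite m0 mltd => /(_ isT)/eqP.
rewrite -(divnK md) mulnC gauss_prim_mul // ((pcharf0P K).1 charK0).
by rewrite eqn0Ngt divn_gt0 // ltnW.
Qed.

End GaussRootOfUnity.

(** * The convolution algebra dual to C_d(n) *)

Section WeightFunctionals.
Variables (K : fieldType) (n d : nat).
Hypothesis n_gt0 : (0 < n)%N.
Local Notation C := (Cd_space K n d).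
Local Notation p := (pathv K n d).

(** The elements of the dual algebra that are homogeneous of degree l: the path
of length l starting at i has the value a i. With this description the
convolution product is the multiplication of a truncated skew polynomial ring
over the functions on the vertices ([conv_wsum]). *)
Definition wsum (a : nat -> K) (l : nat) (h : C) : K^o :=
  \sum_(q : tpath n d) h q * (a q.1 * ((q.2 : nat) == l)%:R).

Lemma wsum_is_linear a l : linear (wsum a l).
Proof.
move=> c x y; rewrite /wsum scaler_sumr -big_split /=.
by apply: eq_bigr => q _; rewrite !ffunE mulrDl -mulrA.
Qed.

HB.instance Definition _ a l :=
  GRing.isLinear.Build K C K^o *:%R (wsum a l) (wsum_is_linear a l).

Lemma wsum_path a l i m : (m < d)%N ->
  wsum a l (p i m) = a (i %% n)%N * (m == l)%:R.
Proof.
move=> md; rewrite -pathv_mod.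
have im : (i %% n < n)%N by rewrite ltn_mod.
exact: (@Cd_sum_pathv K n d K^o (fun q => a q.1 * ((q.2 : nat) == l)%:R)
  (Ordinal im) (Ordinal md)).
Qed.

Lemma wsum_ge a l h : (d <= l)%N -> wsum a l h = 0.
Proof.
move=> dl; apply: big1 => q _.
by rewrite (ltn_eqF (leq_trans (ltn_ord q.2) dl)) !mulr0.
Qed.

Definition conv (f g : C -> K^o) (z : tensor C C) : K^o :=
  tlift (fun x y => (f x : K) * (g y : K) : K^o) z.

HB.instance Definition _ f g := GRing.Linear.copy (conv f g) (conv f g).

Lemma conv_tens (f g : {linear C -> K^o}) x y :
  conv f g (x ⊗ y) = (f x : K) * (g y : K).
Proof.
rewrite /conv tlift_tens // => [w|v] a s t; rewrite linearP.
  by rewrite mulrDl -mulrA.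
by rewrite mulrDr mulrCA.
Qed.

Lemma conv_wsum a b l m h :
  conv (wsum a l) (wsum b m) (Cd_Delta h) =
  wsum (fun k => a ((k + m) %% n)%N * b k) (l + m) h.
Proof.
apply: (Cd_linear_ext (f := conv (wsum a l) (wsum b m) \o @Cd_Delta K n d))
  => i L n0 Ld /=.
rewrite Cd_DeltaE // linear_sum wsum_path //=.
have term r : (r < L.+1)%N ->
    conv (wsum a l) (wsum b m) (p (i + r) (L - r) ⊗ p i r) =
    a ((i + r) %% n)%N * b (i %% n)%N * ((L - r == l) && (r == m))%N%:R.
  move=> rL; rewrite conv_tens /= !wsum_path ?(leq_ltn_trans _ Ld) //.
    by rewrite mulrACA -natrM mulnb.
  exact: leq_subr.
under eq_bigr => r _ do rewrite term //.
have [Llm|Llm] := eqVneq L (l + m)%N; last first.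
  rewrite mulr0 big1 // => r _; have rL := leq_ord r.
  rewrite (_ : (L - r == l)%N && (nat_of_ord r == m) = false) ?mulr0 //.
  by apply/negbTE; apply: contra Llm => /andP[/eqP <- /eqP <-]; rewrite subnK.
have mL : (m < L.+1)%N by rewrite Llm ltnS leq_addl.
rewrite (bigD1 (Ordinal mL)) //= big1 ?addr0 => [|r /negbTE rm].
  by rewrite Llm addnK !eqxx modnDml.
by rewrite -[X in _ && X]/(r == Ordinal mL) rm andbF mulr0.
Qed.

Definition len (l : nat) : C -> K^o := wsum (fun=> 1) l.
Definition coef (k l : nat) : C -> K^o := wsum (fun i => (i == k %% n)%N%:R) l.

HB.instance Definition _ l := GRing.Linear.copy (len l) (len l).
HB.instance Definition _ k l := GRing.Linear.copy (coef k l) (coef k l).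

Lemma len_path l i m : (m < d)%N -> len l (p i m) = (m == l)%:R.
Proof. by move=> md; rewrite /len wsum_path // mul1r. Qed.

Lemma coef_path k l i m : (m < d)%N ->
  coef k l (p i m) = ((i == k %[mod n]) && (m == l))%:R.
Proof. by move=> md; rewrite /coef wsum_path // -natrM mulnb. Qed.

Lemma conv_len l m h :
  conv (len l) (len m) (Cd_Delta h) = len (l + m) h.
Proof. by rewrite conv_wsum /len /wsum; under eq_bigr do rewrite mul1r. Qed.

Lemma conv_len_coef k l m h :
  conv (len l) (coef k m) (Cd_Delta h) = coef k (l + m) h.
Proof. by rewrite conv_wsum /coef /wsum; under eq_bigr do rewrite mul1r. Qed.

(** The idempotent dual to a vertex selects, from the left, the paths ending
there. *)
Lemma conv_coef_vertex j k m h :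
  conv (coef j 0) (coef k m) (Cd_Delta h) =
  (k + m == j %[mod n])%:R * coef k m h.
Proof.
rewrite conv_wsum /coef /wsum add0n mulr_sumr; apply: eq_bigr => q _.
rewrite [RHS]mulrCA; congr (_ * _); rewrite [RHS]mulrA; congr (_ * _).
case: (eqVneq (nat_of_ord q.1) _) => [->|]; last by rewrite !mulr0.
by rewrite modnDml !mulr1.
Qed.

Lemma sum_coef_path (h : C) :
  h = \sum_(q : tpath n d) coef q.1 q.2 h *: p q.1 q.2.
Proof.
rewrite {1}[h]Cd_space_sum; apply: eq_bigr => q _; congr (_ *: _).
rewrite /coef /wsum (bigD1 q) //= big1 ?addr0 => [|r rq].
  by rewrite modn_small // !eqxx !mulr1.
rewrite modn_small // -natrM mulnb.
rewrite -[X in nat_of_bool X]/((r.1 == q.1) && (r.2 == q.2)).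
by rewrite -xpair_eqE -!surjective_pairing (negbTE rq) mulr0.
Qed.

Lemma counit_len h : Cd_counit h = len 0 h.
Proof.
rewrite /Cd_counit /len /wsum.
by apply: eq_bigr => q _; rewrite mul1r.
Qed.

End WeightFunctionals.

(** * Linear maps on tensors given as sums *)

Section TensorOfSums.
Variable K : fieldType.
Implicit Types V W U : vectType K.

Lemma tensZl V W c (x : V) (y : W) : (c *: x) ⊗ y = c *: (x ⊗ y).
Proof. by apply/matrixP => i j; rewrite !mxE linearZ mulrA. Qed.

Lemma tlift_sum V W U (f : V -> W -> U) (I : finType) (x : I -> V) (y : I -> W) :
  (forall w, linear (f^~ w)) -> (forall v, linear (f v)) ->
  tlift f (\sum_i x i ⊗ y i) = \sum_i f (x i) (y i).
Proof.
by move=> fl fr; rewrite linear_sum; apply: eq_bigr => i _; apply: tlift_tens.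
Qed.

Lemma tlift_linear_param V W U (Z : lmodType K) (f : Z -> V -> W -> U) z :
  (forall x y, linear (fun t => f t x y)) -> linear (fun t => tlift (f t) z).
Proof.
move=> fl a s t; rewrite /tlift scaler_sumr -big_split /=.
apply: eq_bigr => i _; rewrite scaler_sumr -big_split /=.
by apply: eq_bigr => j _; rewrite fl scalerDr !scalerA mulrC.
Qed.

Lemma tlift_mul_sum V (m : V -> V -> V) (I J : finType)
    (x1 x2 : I -> V) (y1 y2 : J -> V) :
  (forall y, linear (m^~ y)) -> (forall x, linear (m x)) ->
  tlift (fun u1 u2 =>
    tlift (fun v1 v2 => m u1 v1 ⊗ m u2 v2) (\sum_j y1 j ⊗ y2 j))
    (\sum_i x1 i ⊗ x2 i) =
  \sum_i \sum_j m (x1 i) (y1 j) ⊗ m (x2 i) (y2 j).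
Proof.
move=> ml mr; rewrite tlift_sum => [|w|v]; first apply: eq_bigr => i _.
- by rewrite tlift_sum // => [w|v] c s t; rewrite ?ml ?mr ?tens_linearl ?linearP.
- by apply: tlift_linear_param => v1 v2 c s t; rewrite ml tens_linearl.
- by apply: tlift_linear_param => v1 v2 c s t; rewrite ml linearP.
Qed.

End TensorOfSums.

(** * Consequences of a Hopf structure on C_d(n) *)

Section HopfStructureOnTruncatedCycle.
Variables (K : fieldType) (n d : nat).
Hypotheses (n_gt0 : (0 < n)%N) (d_gt1 : (1 < d)%N).
Variable H : hopf_structure (Cd K n d).
Local Notation C := (Cd_space K n d).
Local Notation p := (pathv K n d).
Local Notation len := (@len K n d).
Local Notation coef := (@coef K n d).
Local Notation Delta := (@Cd_Delta K n d).

Definition cmul (x y : C) : C := hmul H (x ⊗ y).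
Local Notation "x ** y" := (cmul x y) (at level 40, left associativity).
Definition cone : C := hone H.

Lemma cmulA x y z : x ** (y ** z) = x ** y ** z.
Proof. exact: (hmulA H). Qed.

Lemma cmul1 x : cone ** x = x.
Proof. exact: (hmul1l H). Qed.

Lemma cmulx1 x : x ** cone = x.
Proof. exact: (hmul1r H). Qed.

Lemma cmul_linearl y : linear (cmul^~ y).
Proof. by move=> c u v; rewrite /cmul tens_linearl linearP. Qed.

Lemma cmul_linearr x : linear (cmul x).
Proof. by move=> c u v; rewrite /cmul !linearP. Qed.

HB.instance Definition _ x := GRing.isLinear.Build K C C *:%R (cmul x) (cmul_linearr x).

Definition cmulr y x := cmul x y.
HB.instance Definition _ y := GRing.isLinear.Build K C C *:%R (cmulr y) (cmul_linearl y).

Lemma Delta_cmul x y : Delta (x ** y) =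
  tlift (fun x1 x2 => tlift (fun y1 y2 => (x1 ** y1) ⊗ (x2 ** y2)) (Delta y)) (Delta x).
Proof. exact: (Delta_mul H). Qed.

Lemma counit_cmul x y : Cd_counit (x ** y) = (Cd_counit x : K) * (Cd_counit y : K).
Proof. exact: (counit_mul H). Qed.

Lemma DeltaE i l : (l < d)%N ->
  Delta (p i l) = \sum_(r < l.+1) (p (i + r) (l - r) ⊗ p i r).
Proof. exact: Cd_DeltaE. Qed.

Lemma Delta_vertex i : Delta (p i 0) = p i 0 ⊗ p i 0.
Proof. by rewrite DeltaE ?(ltnW d_gt1) // big_ord1 addn0 subn0. Qed.

Lemma Delta_mul_path i a j b : (a < d)%N -> (b < d)%N ->
  Delta (p i a ** p j b) =
  \sum_(r < a.+1) \sum_(s < b.+1)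
    (p (i + r) (a - r) ** p (j + s) (b - s)) ⊗ (p i r ** p j s).
Proof.
move=> ad bd; rewrite Delta_cmul !DeltaE // tlift_mul_sum //.
  exact: cmul_linearl.
exact: cmul_linearr.
Qed.

Lemma path_modn i j l : i = j %[mod n] -> p i l = p j l.
Proof. by move=> ij; rewrite -pathv_mod ij pathv_mod. Qed.

(** On a grouplike element every convolution product becomes a product of
values. Hence [len 1] takes a nilpotent value, which is 0, and all coordinates
along paths of positive length vanish; the coordinates at the vertices are
orthogonal idempotents of K with sum 1, so exactly one of them is 1. *)
Lemma grouplike_vertex h :
  Delta h = h ⊗ h -> Cd_counit h = 1 -> exists k, h = p k 0.
Proof.
move=> Dh eh; have d0 := ltnW d_gt1.
have convh (f g : {linear C -> K^o}) : conv f g (Delta h) = (f h : K) * (g h : K).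
  by rewrite Dh conv_tens.
have lenX l : len l h = (len 1 h : K) ^+ l.
  elim: l => [|l IHl]; first by rewrite -counit_len eh.
  by rewrite -add1n -conv_len // convh /= IHl exprS.
have len1 : len 1 h = 0.
  have /eqP := lenX d; rewrite [len d h]wsum_ge // eq_sym expf_eq0.
  by case/andP=> _ /eqP.
have coefh k l : (0 < l)%N -> coef k l h = 0.
  move=> l0; rewrite -[l]addn0 -conv_len_coef // convh /= lenX len1 expr0n.
  by rewrite eqn0Ngt l0 mul0r.
have coefM j k : (coef j 0 h : K) * (coef k 0 h : K) = (k == j %[mod n])%:R * coef k 0 h.
  by rewrite -convh /= conv_coef_vertex // addn0.
have [k hk|h0] := pickP [pred k : 'I_n | coef k 0 h != 0].
  exists k; rewrite (sum_coef_path h) [RHS](sum_coef_path (p k 0)).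
  apply: eq_bigr => -[i l] _; congr (_ *: _); rewrite coef_path //=.
  have [l0|l0] := posnP l; last by rewrite coefh // [0 == _]ltn_eqF // andbF.
  rewrite l0 andbT; apply: (mulfI hk); rewrite coefM !modn_small //.
  have [<-|ik] := eqVneq (nat_of_ord i) k; last by rewrite mul0r mulr0.
  by rewrite mul1r mulr1.
suff h00 : h = 0 by move/eqP: eh; rewrite h00 linear0 eq_sym oner_eq0.
rewrite (sum_coef_path h) big1 // => -[i l] _ /=.
have [->|l0] := posnP l; last by rewrite coefh // scale0r.
by have /negbFE/eqP-> := h0 i; rewrite scale0r.
Qed.

Lemma vertexM i j : exists k, p i 0 ** p j 0 = p k 0.
Proof.
have d0 := ltnW d_gt1.
apply: grouplike_vertex.
  by rewrite Delta_mul_path // !big_ord1 !addn0 !subn0.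
by rewrite counit_cmul !Cd_counitE // mulr1.
Qed.

Lemma cone_vertex : exists o, cone = p o 0.
Proof. exact: (grouplike_vertex (Delta_one H) (counit_one H)). Qed.

(** A skew primitive element between two vertices s and t lies in the span of
the vertices and, if there is one, of the arrow from s to t. The coefficient of
this arrow is the value of [len 1]. *)
Section SkewPrimitive.
Variables (y : C) (s t : nat).
Hypothesis Dy : Delta y = y ⊗ p s 0 + p t 0 ⊗ y.

Lemma conv_skew (f g : {linear C -> K^o}) :
  conv f g (Delta y) =
  (f y : K) * (g (p s 0) : K) + (f (p t 0) : K) * (g y : K).
Proof. by rewrite Dy linearD /= !conv_tens. Qed.

Lemma skew_coef k l : (0 < l)%N ->
  coef k l y = ((l == 1%N) && (s == k %[mod n]))%:R * (len 1 y : K).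
Proof.
have d0 := ltnW d_gt1; case: l => // l _.
rewrite -[l.+1]addn0 -conv_len_coef // conv_skew /= coef_path // len_path //.
rewrite mul0r addr0 addn0 andbT mulrC; case: l => [|l] //=.
suff -> : len l.+2 y = 0 by rewrite mulr0 mul0r.
rewrite -(addn1 l.+1) -conv_len // conv_skew /= !len_path //.
by rewrite mulr0 mul0r addr0.
Qed.

Lemma skew_target : len 1 y != 0 -> t = s.+1 %[mod n].
Proof.
have d0 := ltnW d_gt1.
move=> y1; apply/eqP; have := conv_coef_vertex n_gt0 s.+1 s 1 y.
have c1 : coef s 1 y != 0 by rewrite skew_coef // !eqxx mul1r.
rewrite conv_skew /= !coef_path // addn1 !eqxx /= mulr0 add0r mul1r andbT.
by case: eqP => // _ /eqP; rewrite mul0r eq_sym (negbTE c1).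
Qed.

Lemma skew_eval (f : {linear C -> K^o}) : (forall k, f (p k 0) = 0) ->
  f y = (len 1 y : K) * (f (p s 1) : K).
Proof.
move=> f0; have sn : (s %% n < n)%N by rewrite ltn_mod.
rewrite [in LHS](sum_coef_path y) linear_sum /=.
rewrite (bigD1 (Ordinal sn, Ordinal d_gt1)) //= big1 ?addr0 => [|[i l] /= q1].
  by rewrite linearZ /= skew_coef // modn_mod !eqxx mul1r pathv_mod.
rewrite linearZ /=; have [->|l0] := posnP l; first by rewrite f0 scaler0.
rewrite skew_coef //; move: q1; rewrite xpair_eqE -!val_eqE /=.
rewrite [(i %% n)%N]modn_small // [(s %% n)%N == i]eq_sym andbC => /negbTE->.
by rewrite mul0r scale0r.
Qed.

End SkewPrimitive.

Lemma Delta_arrow_vertex i j s t :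
  p i 0 ** p j 0 = p s 0 -> p i.+1 0 ** p j 0 = p t 0 ->
  Delta (p i 1 ** p j 0) =
  (p i 1 ** p j 0) ⊗ p s 0 + p t 0 ⊗ (p i 1 ** p j 0).
Proof.
move=> es et; rewrite Delta_mul_path ?(ltnW d_gt1) // big_ord_recr big_ord1 /=.
by rewrite !big_ord1 !addn0 !subn0 addn1 subnn es et.
Qed.

Lemma Delta_vertex_arrow i j s t :
  p i 0 ** p j 0 = p s 0 -> p i 0 ** p j.+1 0 = p t 0 ->
  Delta (p i 0 ** p j 1) =
  (p i 0 ** p j 1) ⊗ p s 0 + p t 0 ⊗ (p i 0 ** p j 1).
Proof.
move=> es et; rewrite Delta_mul_path ?(ltnW d_gt1) // big_ord1 big_ord_recr /=.
by rewrite big_ord1 /= !addn0 !subn0 addn1 subnn es et.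
Qed.

Lemma len_vertexM l i j : (0 < l)%N -> len l (p i 0 ** p j 0) = 0.
Proof.
by case: l => // l _; have [k ->] := vertexM i j; rewrite len_path ?(ltnW d_gt1).
Qed.

Lemma len_arrow_vertex_vertex i j k s : p i 0 ** p j 0 = p s 0 ->
  len 1 (p i 1 ** p j 0 ** p k 0) =
  (len 1 (p i 1 ** p j 0) : K) * (len 1 (p s 1 ** p k 0) : K).
Proof.
move=> es; have [t et] := vertexM i.+1 j.
apply: (skew_eval (Delta_arrow_vertex es et) (f := len 1 \o cmulr (p k 0))).
by move=> m; apply: len_vertexM.
Qed.

Lemma len_vertex_vertex_arrow i j k s : p i 0 ** p j 0 = p s 0 ->
  len 1 (p k 0 ** (p i 0 ** p j 1)) =
  (len 1 (p i 0 ** p j 1) : K) * (len 1 (p k 0 ** p s 1) : K).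
Proof.
move=> es; have [t et] := vertexM i j.+1.
apply: (skew_eval (Delta_vertex_arrow es et) (f := len 1 \o cmul (p k 0))).
by move=> m; apply: len_vertexM.
Qed.

Lemma len_vertex_arrow_vertex i j k s : p i 0 ** p j 0 = p s 0 ->
  len 1 (p i 0 ** p j 1 ** p k 0) =
  (len 1 (p i 0 ** p j 1) : K) * (len 1 (p s 1 ** p k 0) : K).
Proof.
move=> es; have [t et] := vertexM i j.+1.
apply: (skew_eval (Delta_vertex_arrow es et) (f := len 1 \o cmulr (p k 0))).
by move=> m; apply: len_vertexM.
Qed.

Lemma vertex_inj i j : p i 0 = p j 0 -> i = j %[mod n].
Proof.
have d0 := ltnW d_gt1 => /(congr1 (coef j 0)); rewrite !coef_path // !eqxx !andbT.
by case: eqP => //= _ /eqP; rewrite mulr0n mulr1n eq_sym oner_eq0.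
Qed.

(** Left multiplication by a vertex is injective thanks to the antipode, so it
permutes the finite set of vertices and reaches the unit. *)
Lemma vertex_inverse j : exists k, p j 0 ** p k 0 = cone.
Proof.
have d0 := ltnW d_gt1; have [o cone_o] := cone_vertex.
have [S Se] : exists S, S ** p j 0 = cone.
  exists (antipode H (p j 0)); have := antipodel H (p j 0).
  rewrite [Defs.Delta _]Delta_vertex -[counit _]/(Cd_counit (p j 0)).
  rewrite Cd_counitE // scale1r tlift_tens // => [w|v] c s t.
    by rewrite linearP tens_linearl linearP.
  by rewrite !linearP.
have fP (i : 'I_n) : exists k : 'I_n, p j 0 ** p i 0 == p k 0.
  have [k jk] := vertexM j i; have kn : (k %% n < n)%N by rewrite ltn_mod.
  by exists (Ordinal kn); rewrite jk /= pathv_mod.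
pose f i := xchoose (fP i).
have fE (i : 'I_n) : p j 0 ** p i 0 = p (f i) 0 by apply/eqP; exact: xchooseP (fP i).
have f_inj : injective f.
  move=> i i' ff; apply: val_inj => /=;
  rewrite -(modn_small (ltn_ord i)) -(modn_small (ltn_ord i')).
  by apply: vertex_inj; rewrite -[LHS]cmul1 -[RHS]cmul1 -Se -!cmulA !fE ff.
have on : (o %% n < n)%N by rewrite ltn_mod.
exists (iinv (injF_onto f_inj (Ordinal on))).
by rewrite fE f_iinv /= pathv_mod.
Qed.

(** Products are filtered by length: [len l] is an l-fold convolution power of
[len 1], which vanishes on products of vertices. *)
Lemma len_mul_lt l i a j b : (a < d)%N -> (b < d)%N -> (a + b < l)%N ->
  len l (p i a ** p j b) = 0.
Proof.
elim: l i a j b => // -[_|l IHl] i a j b ad bd abl.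
  have -> : a = 0%N by lia.
  have -> : b = 0%N by lia.
  exact: len_vertexM.
rewrite -add1n -conv_len // Delta_mul_path // linear_sum big1 //= => r _.
rewrite linear_sum big1 //= => s _; rewrite conv_tens /=.
have ra := leq_ord r; have sb := leq_ord s.
have [rsl|lrs] := ltnP (r + s) l.+1.
  by rewrite IHl ?mulr0 // ?(leq_ltn_trans ra) ?(leq_ltn_trans sb).
have -> : (a - r)%N = 0%N by lia.
have -> : (b - s)%N = 0%N by lia.
by rewrite len_vertexM // mul0r.
Qed.

(** In the convolution of [len 1] and [len (a + b).+1], the filtration leaves
only the terms where exactly one arrow is split off, from either of the two
paths. *)
Lemma len_mul_rec i a j b : (a.+1 < d)%N -> (b.+1 < d)%N ->
  len (a + b).+2 (p i a.+1 ** p j b.+1) =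
  (len 1 (p (i + a) 1 ** p (j + b.+1) 0) : K) *
    (len (a + b).+1 (p i a ** p j b.+1) : K) +
  (len 1 (p (i + a.+1) 0 ** p (j + b) 1) : K) *
    (len (a + b).+1 (p i a.+1 ** p j b) : K).
Proof.
move=> ad bd; rewrite -add1n -conv_len // Delta_mul_path // linear_sum /=.
have small r s x : (r < d)%N -> (s < d)%N -> (r + s < (a + b).+1)%N ->
    conv (len 1) (len (a + b).+1) (x ⊗ (p i r ** p j s)) = 0.
  by move=> rd sd rs; rewrite conv_tens /= len_mul_lt // mulr0.
(* Of the outer sum, only the terms r = a and r = a + 1 survive. *)
rewrite 2!big_ord_recr big1 ?add0r /= => [|r _]; last first.
  rewrite linear_sum big1 //= => s _.
  by have := ltn_ord r; have := ltn_ord s => ? ?; apply: small; lia.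
congr (_ + _); rewrite linear_sum big_ord_recr /=.
  rewrite big1 ?add0r => [|s _]; last first.
    by have := ltn_ord s => ?; apply: small; lia.
  by rewrite conv_tens /= subnn subSnn.
rewrite big_ord_recr /= big1 ?add0r => [|s _]; last first.
  by have := ltn_ord s => ?; apply: small; lia.
rewrite !conv_tens /= !subnn subSnn len_vertexM // mul0r addr0 //.
Qed.

(** The unit of the algebra may be any vertex o; paths are now numbered starting
from it. *)
Section UnitVertex.
Variable o : nat.
Hypothesis cone_o : cone = p o 0.

Definition upath i l := p (o + i) l.

Lemma upath_modn i j l : i = j %[mod n] -> upath i l = upath j l.
Proof. by move=> ij; apply: path_modn; rewrite -modnDmr ij modnDmr. Qed.

Lemma upath0 : upath 0 0 = cone.
Proof. by rewrite /upath addn0. Qed.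

(** An arrow times a vertex is skew primitive, and its arrow component is not 0
because multiplying by the inverse vertex gives the arrow back. So it joins
consecutive vertices, which computes (e_(i+1)) e_j from e_i e_j. *)
Lemma upath_vertexM i j : upath i 0 ** upath j 0 = upath (i + j) 0.
Proof.
elim: i => [|i IHi]; first by rewrite upath0 cmul1.
have [t et] := vertexM (o + i).+1 (o + j).
have [k jk] := vertex_inverse (o + j).
rewrite /upath addnS et; apply: path_modn; rewrite addSn addnS.
apply: (skew_target (Delta_arrow_vertex IHi et)).
have := len_arrow_vertex_vertex k IHi.
rewrite -cmulA jk cmulx1 len_path // eqxx; apply: contra_eq_neq => ->.
by rewrite mul0r oner_eq0.
Qed.

Definition ucoef i j : K := len 1 (upath i 1 ** upath j 0).
Definition vcoef i j : K := len 1 (upath i 0 ** upath j 1).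

Lemma ucoefM i j k : ucoef i j * ucoef (i + j) k = ucoef i (j + k).
Proof.
rewrite [RHS]/ucoef -upath_vertexM cmulA.
by rewrite (len_arrow_vertex_vertex _ (upath_vertexM i j)).
Qed.

Lemma vcoefM i j k : vcoef i j * vcoef k (i + j) = vcoef (k + i) j.
Proof.
rewrite [RHS]/vcoef -upath_vertexM -cmulA.
by rewrite (len_vertex_vertex_arrow _ (upath_vertexM i j)).
Qed.

Lemma uvcoefM i j k : vcoef i j * ucoef (i + j) k = ucoef j k * vcoef i (j + k).
Proof.
transitivity (len 1 (upath i 0 ** upath j 1 ** upath k 0) : K).
  by rewrite (len_vertex_arrow_vertex _ (upath_vertexM i j)).
rewrite -cmulA; have [t et] := vertexM (o + j).+1 (o + k).
apply: (skew_eval (Delta_arrow_vertex (upath_vertexM j k) et)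
  (f := len 1 \o cmul (upath i 0))).
by move=> m; apply: len_vertexM.
Qed.

Lemma ucoef0 i j : j = 0 %[mod n] -> ucoef i j = 1.
Proof. by move=> j0; rewrite /ucoef (upath_modn _ j0) upath0 cmulx1 len_path ?eqxx. Qed.

Lemma vcoef0 i j : i = 0 %[mod n] -> vcoef i j = 1.
Proof. by move=> i0; rewrite /vcoef (upath_modn _ i0) upath0 cmul1 len_path ?eqxx. Qed.

Lemma vcoef_neq0 i : vcoef i 0 != 0.
Proof.
have : vcoef i 0 * vcoef (i * n.-1) i = 1.
  have := vcoefM i 0 (i * n.-1); rewrite addn0 => ->; apply: vcoef0.
  by rewrite addnC -mulnS prednK // modnMl mod0n.
by apply: contra_eq_neq => ->; rewrite mul0r eq_sym oner_eq0.
Qed.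

(** The function v is a cocycle in its first index, hence the coboundary of
w_i = v_i0. Commuting a vertex on the right past one on the left expresses u
through u_0j and v, and then u_0j / w_j is multiplicative in j: it is q^j,
where q = u_01 / w_1. *)
Lemma exists_twist : exists q : K, exists w : nat -> K,
  [/\ q ^+ n = 1, forall i, w i != 0,
      forall i j, vcoef i j * w j = w (i + j)%N
    & forall i j, ucoef i j * w i = q ^+ j * w (i + j)%N].
Proof.
pose w i := vcoef i 0; pose q := ucoef 0 1 / w 1%N; exists q, w.
have vw i j : vcoef i j * w j = w (i + j)%N.
  by have := vcoefM j 0 i; rewrite addn0 mulrC.
have uw i j : ucoef i j * w i = ucoef 0 j * vcoef i j.
  by have := uvcoefM i 0 j; rewrite addn0 add0n => <-; rewrite mulrC.
have u0 j : ucoef 0 j = q ^+ j * w j.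
  elim: j => [|j IHj]; first by rewrite ucoef0 // /w vcoef0 // mulr1.
  rewrite -[in LHS]addn1 -ucoefM add0n IHj -mulrA [w j * _]mulrC uw exprSr.
  rewrite (_ : w j.+1 = vcoef j 1 * w 1%N); last by rewrite vw addn1.
  rewrite /q -!mulrA; congr (_ * (_ * _)).
  by rewrite mulrCA mulVf ?mulr1 ?vcoef_neq0.
split=> // [|i|i j]; last by rewrite uw u0 -mulrA [w j * _]mulrC vw.
- have := u0 n; rewrite ucoef0 ?modnn ?mod0n // /w vcoef0 ?modnn ?mod0n //.
  by rewrite mulr1.
- exact: vcoef_neq0.
Qed.

(** The factors w enter the recursion for the left-hand side as the
coboundary of the products of the first values of w; clearing them leaves
exactly the Pascal rule [gaussS]. *)
Lemma len_mul_gauss q (w : nat -> K) a b :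
  (forall i, w i != 0) ->
  (forall i j, vcoef i j * w j = w (i + j)%N) ->
  (forall i j, ucoef i j * w i = q ^+ j * w (i + j)%N) ->
  (a < d)%N -> (b < d)%N ->
  (len (a + b) (upath 0 a ** upath 0 b) : K) * (\prod_(i < a) w i * \prod_(i < b) w i) =
  gauss q (a + b) a * \prod_(i < a + b) w i.
Proof.
move=> wn0 vw uw.
have e0 : upath 0 0 = cone by exact: upath0.
elim: a b => [|a IHa] b ad bd.
  by rewrite e0 cmul1 len_path // eqxx big_ord0 gaussn0 !mul1r.
elim: b bd => [|b IHb] bd.
  by rewrite e0 cmulx1 addn0 len_path // eqxx big_ord0 gaussnn mulr1.
have Ha := IHa b.+1 (ltnW ad) bd; have Hb := IHb (ltnW bd).
have Hu := uw a b.+1; have Hv := vw a.+1 b.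
move: Ha Hb Hu Hv; rewrite /vcoef /ucoef /upath !addSn !addnS !addn0.
have -> : gauss q (a + b).+2 a.+1 =
    q ^+ b.+1 * gauss q (a + b).+1 a + gauss q (a + b).+1 a.+1.
  by rewrite gaussS -addnS addKn.
rewrite !big_ord_recr /= len_mul_rec // !addnS => Ha Hb Hu Hv.
set U := (len 1 _ : K) in Hu *; set V := (len 1 _ : K) in Hv *.
set N1 := (len _ _ : K) in Ha *; set N2 := (len _ _ : K) in Hb *.
set A := \prod_(i < a) _ in Ha Hb *; set B := \prod_(i < b) _ in Ha Hb *.
transitivity (U * w a * (N1 * (A * (B * w b))) + V * w b * (N2 * (A * w a * B))).
  ring.
rewrite Hu Hv Ha Hb; ring.
Qed.

End UnitVertex.

Lemma hopf_structure_dvdn : [pchar K] =i pred0 -> (d %| n)%N.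
Proof.
move=> charK0; have [o cone_o] := cone_vertex.
have [q [w [qn wn0 vw uw]]] := exists_twist cone_o.
suff qd : d.-primitive_root q by rewrite (prim_order_dvd qd) qn.
apply: gauss_eq0_prim => // a /andP[a0 ad].
have bd : (d - a < d)%N by lia.
have := len_mul_gauss cone_o wn0 vw uw ad bd; rewrite subnKC ?(ltnW ad) //.
rewrite [len d _]wsum_ge // mul0r => /esym/eqP; rewrite mulf_eq0.
have /negPf -> : \prod_(i < d) w i != 0 by apply/prodf_neq0.
by rewrite orbF => /eqP.
Qed.

End HopfStructureOnTruncatedCycle.

(** * The generalized Taft structure on C_d(n) *)

Section TwistedDividedPowers.
Variables (K : fieldType) (n d : nat) (q : K).
Hypotheses (n_gt0 : (0 < n)%N) (d_gt1 : (1 < d)%N).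
Hypotheses (qd : d.-primitive_root q) (qn : q ^+ n = 1).
Local Notation C := (Cd_space K n d).
Local Notation p := (pathv K n d).
Local Notation Delta := (@Cd_Delta K n d).

Lemma pathv_ge i l : (d <= l)%N -> p i l = 0.
Proof.
move=> dl; apply/ffunP => r; rewrite !ffunE.
by rewrite (ltn_eqF (leq_trans (ltn_ord r.2) dl)) andbF.
Qed.

Lemma expq_modn m i : q ^+ (i %% n * m) = q ^+ (i * m).
Proof.
by rewrite [in RHS](divn_eq i n) mulnDl exprD -mulnA mulnCA [q ^+ (n * _)]exprM
  qn expr1n mul1r.
Qed.

Lemma linear_ext (U : lmodType K) (f g : C -> U) : linear f -> linear g ->
  (forall i l, (l < d)%N -> f (p i l) = g (p i l)) -> f =1 g.
Proof.
move=> fl gl fg.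
pose F : {linear C -> U} := HB.pack f (GRing.isLinear.Build K C U *:%R f fl).
pose G : {linear C -> U} := HB.pack g (GRing.isLinear.Build K C U *:%R g gl).
by apply: (Cd_linear_ext (f := F) (g := G)) => i l _ ld; apply: fg.
Qed.

Definition path_extend (U : lmodType K) (F : nat -> nat -> U) (x : C) : U :=
  \sum_(r : tpath n d) (x r : K) *: F r.1 r.2.

Lemma path_extend_linear (U : lmodType K) (F : nat -> nat -> U) : linear (path_extend F).
Proof.
move=> c x y; rewrite /path_extend scaler_sumr -big_split /=.
by apply: eq_bigr => r _; rewrite !ffunE scalerDl scalerA.
Qed.

HB.instance Definition _ (U : lmodType K) (F : nat -> nat -> U) :=
  GRing.isLinear.Build K C U *:%R (path_extend F) (path_extend_linear F).

Lemma path_extendE (U : lmodType K) (F : nat -> nat -> U) i l :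
  (l < d)%N -> path_extend F (p i l) = F (i %% n)%N l.
Proof.
move=> ld; rewrite -pathv_mod; have im : (i %% n < n)%N by rewrite ltn_mod.
exact: (Cd_sum_pathv (fun r => F r.1 r.2) (Ordinal im) (Ordinal ld)).
Qed.

Lemma path_extend_param (U Z : lmodType K) (F : Z -> nat -> nat -> U) x :
  (forall i l, linear (fun t => F t i l)) -> linear (fun t => path_extend (F t) x).
Proof.
move=> Fl c s t; rewrite /path_extend scaler_sumr -big_split /=.
by apply: eq_bigr => r _; rewrite Fl scalerDr !scalerA mulrC.
Qed.

Definition tmul (x y : C) : C :=
  path_extend (fun i l => path_extend (fun j m =>
    (q ^+ (j * l) * gauss q (l + m) l) *: p (i + j) (l + m)) y) x.

Lemma tmul_linearl y : linear (tmul^~ y).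
Proof. exact: path_extend_linear. Qed.

Lemma tmul_linearr x : linear (tmul x).
Proof. by apply: path_extend_param => i l; apply: path_extend_linear. Qed.

HB.instance Definition _ x :=
  GRing.isLinear.Build K C C *:%R (tmul x) (tmul_linearr x).

Lemma tmulZl c x y : tmul (c *: x) y = c *: tmul x y.
Proof. by rewrite /tmul linearZ. Qed.

(** When l or m is at least d, both sides vanish, as the paths of length l + m
and of length l or m are then represented by 0. *)
Lemma tmulE i l j m :
  tmul (p i l) (p j m) =
  (q ^+ (j * l) * gauss q (l + m) l) *: p (i + j) (l + m).
Proof.
have [dl|ld] := leqP d l.
  have -> : p (i + j) (l + m) = 0 by rewrite pathv_ge // (leq_trans dl) ?leq_addr.
  by rewrite (pathv_ge i dl) /tmul linear0 scaler0.
have [dm|md] := leqP d m.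
  have -> : p (i + j) (l + m) = 0 by rewrite pathv_ge // (leq_trans dm) ?leq_addl.
  by rewrite (pathv_ge j dm) linear0 scaler0.
rewrite /tmul !path_extendE // expq_modn.
by rewrite -pathv_mod modnDm pathv_mod.
Qed.

(** Both sides are the q-multinomial coefficient; below d the q-factorials are
invertible, and from d on the path that carries these coefficients is 0. *)
Lemma gauss_assoc l m r : (l + m + r < d)%N ->
  gauss q (m + r) m * gauss q (l + (m + r)) l =
  gauss q (l + m) l * gauss q (l + m + r) (l + m).
Proof.
move=> lmr.
have f0 k : (k <= l + m + r)%N -> qfact q k != 0.
  by move=> klmr; apply: (qfact_prim qd); apply: leq_ltn_trans lmr.
have nz : qfact q l * qfact q m * qfact q r * qfact q (m + r) * qfact q (l + m) != 0.
  by rewrite !mulf_neq0 // f0 //; lia.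
apply: (mulIf nz).
have e1 := gauss_fact q m r; have e2 := gauss_fact q l (m + r).
have e3 := gauss_fact q l m; have e4 := gauss_fact q (l + m) r.
rewrite addnA in e2 *.
transitivity ((gauss q (m + r) m * qfact q m * qfact q r) *
   (gauss q (l + m + r) l * qfact q l * qfact q (m + r)) * qfact q (l + m)).
  ring.
rewrite e1 e2 -[in LHS]e3 -[in LHS]e4; ring.
Qed.

Lemma gauss_sym l k : (l < d)%N -> (k <= l)%N -> gauss q l (l - k) = gauss q l k.
Proof.
move=> ld kl; have f0 j : (j <= l)%N -> qfact q j != 0.
  by move=> jl; apply: (qfact_prim qd); apply: leq_ltn_trans ld.
have e1 := gauss_fact q (l - k) k; have e2 := gauss_fact q k (l - k).
rewrite subnK // in e1; rewrite subnKC // in e2.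
apply: (mulIf (mulf_neq0 (f0 k kl) (f0 _ (leq_subr k l)))).
by rewrite [RHS]mulrA e2 -e1 mulrA mulrAC.
Qed.

Lemma tmulA : associative tmul.
Proof.
move=> x y z; move: x.
apply: linear_ext => [|c s t|i l ld]; first exact: tmul_linearl.
  by rewrite !tmul_linearl.
move: y; apply: linear_ext => [c s t|c s t|j m md].
- by rewrite tmul_linearl linearP.
- by rewrite linearP tmul_linearl.
move: z; apply: linear_ext => [c s t|c s t|k r rd]; try by rewrite !linearP.
rewrite !tmulE linearZ /= tmulZl !tmulE !scalerA !addnA.
have [dlmr|lmrd] := leqP d (l + m + r); first by rewrite pathv_ge // !scaler0.
congr (_ *: _).
transitivity (q ^+ (k * m + (j + k) * l) *
  (gauss q (m + r) m * gauss q (l + (m + r)) l)); first by rewrite exprD addnA; ring.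
rewrite gauss_assoc // (_ : k * m + (j + k) * l = j * l + k * (l + m))%N; last by lia.
by rewrite exprD; ring.
Qed.

Lemma tmul1l : left_id (p 0 0) tmul.
Proof.
apply: linear_ext => [c s t|c s t|j m md] //; first by rewrite linearP.
by rewrite tmulE muln0 gaussn0 mulr1 scale1r.
Qed.

Lemma tmul1r : right_id (p 0 0) tmul.
Proof.
apply: linear_ext => [||j m md] //; first exact: tmul_linearl.
by rewrite tmulE mul0n !addn0 gaussnn mulr1 scale1r.
Qed.

Definition tDelta2 (X Y : tensor C C) : tensor C C :=
  tlift (fun x1 x2 => tlift (fun y1 y2 => tmul x1 y1 ⊗ tmul x2 y2) Y) X.

Lemma tDelta2_linearr X : linear (tDelta2 X).
Proof.
apply: (@tlift_linear_param K C C _ _ (fun Y x1 x2 =>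
  tlift (fun y1 y2 => tmul x1 y1 ⊗ tmul x2 y2) Y) X) => x1 x2 c Y Z.
by rewrite linearP.
Qed.

(** Collecting the terms of the right-hand side with r + s = t gives the
q-Vandermonde sum for a cut at t. When l + m >= d the left-hand side is 0, and
so is the Gaussian binomial that the Vandermonde identity produces. *)
Lemma tDelta_path i l j m : (l < d)%N -> (m < d)%N ->
  Delta (tmul (p i l) (p j m)) = tDelta2 (Delta (p i l)) (Delta (p j m)).
Proof.
move=> ld md; rewrite /tDelta2 !Cd_DeltaE // tlift_mul_sum; last 2 first.
- exact: tmul_linearl.
- exact: tmul_linearr.
(* F t is the term of the comultiplication of the product path cut at t. *)
pose F t := p (i + j + t) (l + m - t) ⊗ p (i + j) t.
pose e t r := q ^+ (j * l) *
  (q ^+ ((t - r) * (l - r)) * gauss q (l + m - t) (l - r) * gauss q t r).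
transitivity (\sum_(t < (l + m).+1) (q ^+ (j * l) * gauss q (l + m) l) *: F t).
  have [dlm|lmd] := leqP d (l + m); last first.
    by rewrite tmulE [LHS]linearZ /= Cd_DeltaE // scaler_sumr.
  rewrite tmulE (pathv_ge _ dlm) scaler0 [LHS]linear0 (gauss_prim_eq0 qd) //.
  by rewrite mulr0 big1 // => t _; rewrite scale0r.
transitivity (\sum_(t < (l + m).+1) \sum_(r < l.+1) e t r *: F t).
  apply: eq_bigr => t _; have tlm := leq_ord t.
  rewrite -{1}(subnKC tlm) gauss_vandermonde mulr_sumr scaler_suml.
  by apply: eq_bigr => r _.
rewrite exchange_big; apply: eq_bigr => r _ /=; have rl := leq_ord r.
(* For fixed r, the coefficient e t r vanishes unless r <= t <= r + m. *)
rewrite -(big_mkord xpredT (fun t => e t r *: F t)).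
rewrite (big_cat_nat (n := r)) //=; last by lia.
rewrite big_nat_cond big1 ?add0r => [|t /andP[/andP[_ tr] _]]; last first.
  by rewrite /e [gauss q t r]gauss_small // !mulr0 scale0r.
rewrite (big_cat_nat (n := r + m.+1)) //=; [|by lia..].
rewrite [X in _ + X]big_nat_cond [X in _ + X]big1 ?addr0
  => [|t /andP[/andP[rmt tlm] _]]; last first.
  by rewrite /e [gauss q (_ - t) _]gauss_small ?mulr0 ?mul0r ?mulr0 ?scale0r //; lia.
rewrite -[X in \sum_(X <= _ < _) _]add0n big_addn addKn big_mkord.
apply: eq_bigr => s _; have sm := leq_ord s.
rewrite !tmulE linearZ /= tensZl scalerA /e /F addnK.
rewrite (_ : l + m - (s + r) = l - r + (m - s))%N; last by lia.
rewrite (_ : i + r + (j + s) = i + j + (s + r))%N; last by lia.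
rewrite [(s + r)%N]addnC; congr (_ *: _).
rewrite (_ : (j * l = j * (l - r) + j * r)%N); last by rewrite -mulnDr subnK.
by rewrite mulnDl !exprD; ring.
Qed.

Lemma tDelta_mul x y : Delta (tmul x y) = tDelta2 (Delta x) (Delta y).
Proof.
move: x; apply: linear_ext => [c s t|c s t|i l ld].
- by rewrite tmul_linearl linearP.
- by rewrite /tDelta2 !linearP.
move: y; apply: linear_ext => [c s t|c s t|j m md].
- by rewrite !linearP.
- by rewrite linearP tDelta2_linearr.
exact: tDelta_path.
Qed.

Lemma tcounit_mul x y :
  Cd_counit (tmul x y) = (Cd_counit x : K) * (Cd_counit y : K).
Proof.
move: x; apply: linear_ext => [c s t|c s t|i l ld].
- by rewrite tmul_linearl linearP.
- by rewrite linearP mulrDl -mulrA.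
move: y; apply: linear_ext => [c s t|c s t|j m md].
- by rewrite !linearP.
- by rewrite linearP mulrDr mulrCA.
rewrite tmulE linearZ /= [Cd_counit (p i l)]Cd_counitE //.
rewrite [Cd_counit (p j m)]Cd_counitE //.
have [dlm|lmd] := leqP d (l + m).
  rewrite (pathv_ge _ dlm) linear0 scaler0.
  by case: l m {ld md} dlm (leq_trans d_gt1 dlm) => [|l] [|m]; rewrite ?mul0r ?mulr0.
rewrite Cd_counitE // addn_eq0; case: l {ld} lmd => [|l] _; last by rewrite mul0r scaler0.
by rewrite muln0 gaussn0 mulr1 scale1r mul1r.
Qed.

(** The scalar is determined by (g^i x^l / [l]!) and the antimultiplicativity of
the antipode, which sends g to its inverse and x to - g^-1 x. *)
Definition tcoef i l : K := (-1) ^+ l * (q^-1) ^+ (i * l + 'C(l, 2)).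

(** Multiplication by n - 1 is negation of vertices modulo n: the path obtained
starts at - (i + l). *)
Definition tantipode : C -> C :=
  path_extend (fun i l => tcoef i l *: p ((i + l) * n.-1) l).

HB.instance Definition _ := GRing.Linear.copy tantipode tantipode.

Lemma q_neq0 : q != 0.
Proof.
apply: contra_eq_neq (prim_expr_order qd) => ->.
by rewrite expr0n gtn_eqF ?(ltnW d_gt1) // eq_sym oner_eq0.
Qed.

Lemma expqV_modn m i : q^-1 ^+ (i %% n * m) = q^-1 ^+ (i * m).
Proof. by rewrite !exprVn expq_modn. Qed.

Lemma tantipodeE i l : (l < d)%N ->
  tantipode (p i l) = tcoef i l *: p ((i + l) * n.-1) l.
Proof.
move=> ld; rewrite /tantipode path_extendE // /tcoef !exprD expqV_modn.
by rewrite -[p (_ * _) l]pathv_mod -modnMml modnDml modnMml pathv_mod.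
Qed.

Lemma bin2D a b : 'C(a + b, 2) = ('C(a, 2) + 'C(b, 2) + a * b)%N.
Proof.
elim: a => [|a IHa]; first by rewrite bin0n mul0n addn0.
by rewrite addSn !binS !bin1 IHa; lia.
Qed.

(** After multiplication by q^(l (l - 1) / 2) and by the sign (-1)^l, the terms
are those of [gauss_alternating]. *)
Lemma tcoef_sum l : (0 < l < d)%N ->
  \sum_(r < l.+1) (-1) ^+ (l - r) * q^-1 ^+ (r * (l - r) + 'C(l - r, 2)) *
    gauss q l r = 0.
Proof.
move=> /andP[l0 ld]; have q0 := q_neq0.
have /mulfI : q ^+ 'C(l, 2) != 0 by rewrite expf_neq0.
apply; rewrite mulr0 mulr_sumr.
transitivity ((-1) ^+ l *
  \sum_(r < l.+1) (-1) ^+ r * q ^+ 'C(r, 2) * gauss q l r); last first.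
  by case: l l0 {ld} => // l _; rewrite gauss_alternating mulr0.
rewrite mulr_sumr; apply: eq_bigr => r _; have rl := leq_ord r.
have sgn a b : (-1) ^+ a = (-1) ^+ (a + b) * (-1) ^+ b :> K.
  by rewrite exprD -mulrA -expr2 sqrr_sign mulr1.
have := bin2D r (l - r); have := sgn (l - r)%N r; rewrite subnK // subnKC // => -> ->.
rewrite -addnA exprD [('C(l - r, 2) + _)%N]addnC exprVn; field.
by rewrite expf_neq0.
Qed.

Lemma tantipodel x :
  tlift (fun x1 x2 => tmul (tantipode x1) x2) (Delta x) =
  (Cd_counit x : K) *: p 0 0.
Proof.
move: x; apply: linear_ext => [c s t|c s t|i l ld]; first by rewrite !linearP.
  by rewrite linearP scalerDl scalerA.
rewrite Cd_DeltaE // Cd_counitE // tlift_sum => [|y c s t|y]; last 2 first.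
- by rewrite linearP tmul_linearl.
- exact: tmul_linearr.
have term (r : 'I_l.+1) :
  tmul (tantipode (p (i + r) (l - r))) (p i r) =
  ((-1) ^+ (l - r) * q^-1 ^+ (r * (l - r) + 'C(l - r, 2)) * gauss q l r)
    *: p (l * n.-1) l.
  have rl := leq_ord r; have lrd : (l - r < d)%N by apply: leq_ltn_trans ld; lia.
  rewrite tantipodeE // tmulZl tmulE scalerA subnK // gauss_sym //.
  congr (_ *: _).
    rewrite /tcoef mulnDl -addnA exprD; rewrite [q^-1 ^+ (i * _)]exprVn; field.
    by rewrite expf_neq0 // q_neq0.
  rewrite -addnA subnKC // -[RHS]pathv_mod -[LHS]pathv_mod mulnDl addnAC.
  by rewrite -mulnSr prednK // modnMDl.
under eq_bigr => r _ do rewrite term.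
rewrite -scaler_suml; have [l0|l0] := posnP l; last by rewrite tcoef_sum ?l0 // !scale0r.
by rewrite l0 big_ord1 gaussn0 !mul1r !scale1r.
Qed.

Lemma tantipoder x :
  tlift (fun x1 x2 => tmul x1 (tantipode x2)) (Delta x) =
  (Cd_counit x : K) *: p 0 0.
Proof.
move: x; apply: linear_ext => [c s t|c s t|i l ld]; first by rewrite !linearP.
  by rewrite linearP scalerDl scalerA.
rewrite Cd_DeltaE // Cd_counitE // tlift_sum => [|y|y c s t]; last 2 first.
- exact: tmul_linearl.
- by rewrite !linearP.
(* Cutting from the other end makes the terms proportional to those of the
   left antipode axiom. *)
rewrite (reindex_inj rev_ord_inj) /=.
have term (r : 'I_l.+1) :
  tmul (p (i + (l.+1 - r.+1)) (l - (l.+1 - r.+1))) (tantipode (p i (l.+1 - r.+1))) =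
  ((-1) ^+ (l - r) * q^-1 ^+ (r * (l - r) + 'C(l - r, 2)) * gauss q l r)
    *: (q^-1 ^+ (i * l) *: p 0 l).
  have rl := leq_ord r; have lrd : (l - r < d)%N by apply: leq_ltn_trans ld; lia.
  rewrite subSS subKn // tantipodeE // linearZ /= tmulE !scalerA subnKC //.
  have -> : p (i + (l - r) + (i + (l - r)) * n.-1) l = p 0 l.
    by rewrite -mulnS prednK // -pathv_mod modnMl.
  congr (_ *: _); rewrite /tcoef.
  have q0 := q_neq0; have qN k : q ^+ (k * n.-1) = q^-1 ^+ k.
    apply: (mulIf (expf_neq0 k q0)); rewrite -exprD -mulnSr prednK // mulnC exprM qn.
    by rewrite expr1n exprVn mulVf ?expf_neq0.
  rewrite mulnAC qN.
  rewrite [RHS]mulrAC -!mulrA; congr (_ * _); rewrite !mulrA -!exprD; congr (_ ^+ _ * _).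
  nia.
under eq_bigr => r _ do rewrite term.
rewrite -scaler_suml; have [l0|l0] := posnP l; last by rewrite tcoef_sum ?l0 // !scale0r.
by rewrite l0 big_ord1 gaussn0 muln0 !mul1r !scale1r.
Qed.

Definition twisted_hopf_structure : hopf_structure (Cd K n d).
Proof.
have mulE x y : tlift tmul (x ⊗ y) = tmul x y.
  by apply: tlift_tens; [exact: tmul_linearl | exact: tmul_linearr].
have eta (V W U : vectType K) (f g : V -> W -> U) z :
    (forall x y, f x y = g x y) -> tlift f z = tlift g z.
  by move=> fg; apply: eq_bigr => a _; apply: eq_bigr => b _; rewrite fg.
exists (tlift tmul : {linear tensor (Cd K n d) (Cd K n d) -> Cd K n d})
  (p 0 0) tantipode.
- by move=> x y z /=; rewrite !mulE tmulA.
- by move=> x /=; rewrite mulE tmul1l.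
- by move=> x /=; rewrite mulE tmul1r.
- by rewrite /= Cd_DeltaE ?(ltnW d_gt1) // big_ord1.
- move=> x y /=; rewrite mulE [LHS]tDelta_mul.
  by apply: (eta) => x1 x2; apply: (eta) => y1 y2 /=; rewrite !mulE.
- by rewrite /= Cd_counitE ?(ltnW d_gt1).
- by move=> x y /=; rewrite mulE [LHS]tcounit_mul.
- by move=> x; rewrite -[RHS]tantipodel; apply: (eta) => x1 x2 /=; rewrite mulE.
- by move=> x; rewrite -[RHS]tantipoder; apply: (eta) => x1 x2 /=; rewrite mulE.
Qed.

End TwistedDividedPowers.

Theorem theorem3p1 (K : fieldType) (n d : nat)
    (n_gt0 : (0 < n)%N) (d_ge2 : (2 <= d)%N)
    (charK0 : [pchar K] =i pred0)
    (primK : exists z : K, n.-primitive_root z) :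
  inhabited (hopf_structure (Cd K n d)) <-> (d %| n)%N.
Proof.
split=> [[H]|dn]; first exact: (hopf_structure_dvdn n_gt0 d_ge2 H charK0).
have [z zn] := primK; have qd := dvdn_prim_root zn dn.
have qn : (z ^+ (n %/ d)) ^+ n = 1.
  by rewrite exprAC (prim_expr_order zn) expr1n.
exact: inhabits (twisted_hopf_structure n_gt0 d_ge2 qd qn).
Qed.
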